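(* The semantics $\mathit{cf1.5}$ and $\mathit{stg1.5}$ satisfy finitary directionality: for $\sigma\in\{\mathit{cf1.5},\mathit{stg1.5}\}$, whenever $\mathcal{F}$ is a finitary argumentation framework and $U\subseteq A_{\mathcal{F}}$ is not attacked from outside $U$, we have $\sigma(\mathcal{F}|_U)=\{S\cap U:S\in\sigma(\mathcal{F})\}$.
   Context: An argumentation framework (AF) is $\mathcal{F}=(A_{\mathcal{F}},R_{\mathcal{F}})$ with $R_{\mathcal{F}}\subseteq A_{\mathcal{F}}\times A_{\mathcal{F}}$; $a\rightarrow b$ means $(a,b)\in R_{\mathcal{F}}$. $\mathcal{F}$ is finitary if each argument has finitely many attackers. $U$ is not attacked from outside $U$ if there are no $a\in A_{\mathcal{F}}\setminus U$, $b\in U$ with $a\rightarrow b$. $\mathcal{F}|_S=(A_{\mathcal{F}}\cap S,R_{\mathcal{F}}\cap(S\times S))$. Conflict-free: no $a,b\in S$ with $a\rightarrow b$; naive = $\subseteq$-maximal conflict-free; $S^\oplus=S\cup\{x:\exists y\in S,\ y\rightarrow x\}$; stage = conflict-free $S$ with no conflict-free $T$ such that $S^\oplus\subsetneq T^\oplus$. $\mathrm{SCC}(\mathcal{F})$: strongly connected components of the attack graph. $D_S(X)=\{b\in X:\exists a\in S\setminus X,\ a\rightarrow b\}$. $S\in\mathit{cf1.5}(\mathcal{F})$ (resp. $\mathit{stg1.5}(\mathcal{F})$) iff $S$ is conflict-free and for each $X\in\mathrm{SCC}(\mathcal{F})$, $S\cap X$ is a naive (resp. stage) extension of $\mathcal{F}|_{X\setminus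 D_S(X)}$. *)

(* Defs.v *)
(* Argumentation frameworks over an arbitrary carrier type T;
   sets of arguments are predicates T -> Prop (frameworks may be infinite). *)
From Stdlib Require Import List Relations.

Set Implicit Arguments.

Record AF (T : Type) := mkAF { args : T -> Prop; att : T -> T -> Prop }.
Arguments mkAF {T} _ _.

Section Defs.
Variable T : Type.
Implicit Types (F : AF T) (S U X Y : T -> Prop).

Definition wf_AF F : Prop :=
  forall a b, att F a b -> args F a /\ args F b.

Definition finitary F : Prop :=
  forall b, exists l : list T, forall a, att F a b -> In a l.

Definition unattacked F U : Prop :=
  forall a b, args F a -> ~ U a -> U b -> ~ att F a b.

Definition restrict F S : AF T :=
  mkAF (fun x => args F x /\ S x) (fun a b => att F a b /\ S a /\ S b).

Definition subset_of S U : Prop := forall x, S x -> U x.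

Definition conflict_free F S : Prop :=
  subset_of S (args F) /\ forall a b, S a -> S b -> ~ att F a b.

Definition naive F S : Prop :=
  conflict_free F S /\
  forall S', conflict_free F S' -> subset_of S S' -> subset_of S' S.

Definition range F S : T -> Prop :=
  fun x => S x \/ exists y, S y /\ att F y x.

Definition strict_subset S U : Prop :=
  subset_of S U /\ exists x, U x /\ ~ S x.

Definition stage F S : Prop :=
  conflict_free F S /\
  ~ exists S', conflict_free F S' /\ strict_subset (range F S) (range F S').

Definition reach F : T -> T -> Prop := clos_refl_trans T (att F).

Definition is_SCC F X : Prop :=
  exists a, args F a /\
    forall b, X b <-> (args F b /\ reach F a b /\ reach F b a).

Definition Dset F S X : T -> Prop :=
  fun b => X b /\ exists a, S a /\ ~ X a /\ att F a b.

Definition inter S U : T -> Prop := fun x => S x /\ U x.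

Definition cf15 F S : Prop :=
  conflict_free F S /\
  forall X, is_SCC F X ->
    naive (restrict F (fun x => X x /\ ~ Dset F S X x)) (inter S X).

Definition stg15 F S : Prop :=
  conflict_free F S /\
  forall X, is_SCC F X ->
    stage (restrict F (fun x => X x /\ ~ Dset F S X x)) (inter S X).

Definition directional_at (sigma : AF T -> (T -> Prop) -> Prop) F U : Prop :=
  forall E, sigma (restrict F U) E <->
    exists S, sigma F S /\ forall x, E x <-> (S x /\ U x).

End Defs.

(* Main.v *)
(** The naive and the stage condition on a component both ask for a conflict-free
    set whose "range" is maximal. In a finitary framework, whether a finite set of
    arguments lies in the range of some conflict-free set depends on finitely many
    arguments, and every component is countable. A maximal range can therefore be
    built greedily along an enumeration, and each greedy decision on a component
    depends on the status of only finitely many outside attackers. Thus "S covers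
    the greedy range of its component" is a family of finitary constraints on S.
    Finitely many components can be solved one after the other, so compactness
    gives a solution for all of them at once, even when the order of components
    is not well-founded; on U the solution is prescribed. *)
Require Import Defs.
From Stdlib Require Import List Relations.
From Stdlib Require Import Classical ClassicalEpsilon Lia Cantor.
From Stdlib Require Import FunctionalExtensionality PropExtensionality.
From mathcomp Require classical.filter.
Import ListNotations.

Lemma pred_ext (T : Type) (P Q : T -> Prop) : (forall x, P x <-> Q x) -> P = Q.
Proof.
  intro H; apply functional_extensionality; intro x.
  apply propositional_extensionality; apply H.
Qed.

Lemma AF_ext (T : Type) (F G : AF T) :
  (forall x, args F x <-> args G x) ->
  (forall x y, att F x y <-> att G x y) -> F = G.
Proof.
  destruct F as [A R], G as [A' R']; simpl; intros HA HR.
  rewrite (pred_ext _ A A' HA); f_equal.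
  apply functional_extensionality; intro x.
  apply pred_ext; apply HR.
Qed.

(** * Compactness *)

(** Propositional compactness: the families containing all solutions of some finite subfamily form a
    proper filter, and an ultrafilter [G] extending it decides membership of each element. *)
Lemma compactness (T I : Type) (P : I -> (T -> Prop) -> Prop) :
  (forall i, exists L, forall S S', (forall y, In y L -> (S y <-> S' y)) ->
     P i S -> P i S') ->
  (forall l : list I, exists S, forall i, In i l -> P i S) ->
  exists S, forall i, P i S.
Proof.
  intros Hfin Hsat.
  set (B := fun A : (T -> Prop) -> Prop =>
    exists l : list I, forall S, (forall i, In i l -> P i S) -> A S).
  assert (HB : filter.ProperFilter B).
  { constructor.
    - intros [l Hl]; destruct (Hsat l) as [S HS]; exact (Hl S HS).
    - constructor.
      + exists []; intros; exact Logic.I.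
      + intros A A' [l Hl] [l' Hl']; exists (l ++ l'); intros S HS; split.
        * apply Hl; intros; apply HS, in_or_app; auto.
        * apply Hl'; intros; apply HS, in_or_app; auto.
      + intros A A' HA [l Hl]; exists l; intros S HS; apply HA, Hl, HS. }
  destruct (filter.ultraFilterLemma HB) as [G [GU HG]].
  pose proof (@filter.ultra_proper _ _ GU) as GP.
  set (V := fun x => G (fun S => S x)).
  exists V; intro i; destruct (Hfin i) as [L HL].
  (* [G]-almost every set agrees with [V] on a given finite list, so some solution of [P i] agrees
     with [V] on [L]. *)
  assert (HV : forall K, G (fun S => forall y, In y K -> (S y <-> V y))).
  { induction K as [|x K IH].
    - apply filter.filterS with (2 := filter.filterT).
      intros S _ y [].
    - assert (Hx : G (fun S => S x <-> V x)).
      { destruct (@filter.in_ultra_setVsetC _ G (fun S => S x) GU) as [H|H].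
        - apply filter.filterS with (2 := H); intros S HS; split; auto.
        - apply filter.filterS with (2 := H); intros S HS; split.
          + intro H'; destruct (HS H').
          + intro H'; exfalso.
            destruct (filter.filter_ex (filter.filterI H H')) as [S' [H1 H2]].
            exact (H1 H2). }
      apply filter.filterS with (2 := filter.filterI Hx IH).
      intros S [H1 H2] y [<-|Hy]; auto. }
  assert (HP : G (P i)).
  { apply HG; exists [i]; intros S HS; apply HS; left; reflexivity. }
  destruct (filter.filter_ex (filter.filterI HP (HV L))) as [S [H1 H2]].
  exact (HL S V H2 H1).
Qed.

Lemma list_maximal (T : Type) (le : T -> T -> Prop) :
  (forall x y z, le x y -> le y z -> le x z) ->
  forall l : list T, l <> [] ->
  exists x, In x l /\ forall y, In y l -> le x y -> le y x.
Proof.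
  intros Htr; induction l as [|a l IH]; [congruence|intros _].
  destruct l as [|b l].
  - exists a; split; [now left|]; intros y [<-|[]]; auto.
  - destruct IH as [m [Hm Hmax]]; [congruence|].
    destruct (classic (le m a)) as [Hma|Hma].
    + exists a; split; [now left|]; intros y [<-|Hy] Hay; auto.
      apply Htr with m; auto; apply Hmax; auto; eapply Htr; eauto.
    + exists m; split; [now right|]; intros y [<-|Hy] Hmy; auto; contradiction.
Qed.

(* Finitely many classes are solved one after the other along the preorder;
   the solution chosen on a maximal class disturbs none of the others. *)
Lemma preorder_compactness (T I : Type) (le : T -> T -> Prop)
    (P : T -> I -> (T -> Prop) -> Prop) :
  (forall x, le x x) ->
  (forall x y z, le x y -> le y z -> le x z) ->
  (forall x i, exists L, forall S S',
     (forall y, In y L -> le y x -> (S y <-> S' y)) -> P x i S -> P x i S') ->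
  (forall x S0, exists S,
     (forall y, ~ (le x y /\ le y x) -> (S y <-> S0 y)) /\
     (forall y i, le x y -> le y x -> P y i S)) ->
  exists S, forall x i, P x i S.
Proof.
  intros Hrefl Htr Hfin Hloc.
  (* By compactness, finitely many classes suffice. The induction is on the length because the
     maximal element removed need not be the head. *)
  enough (H : forall n (l : list T), length l = n -> exists S, forall x, In x l ->
            forall y i, le x y -> le y x -> P y i S).
  { destruct (compactness T (T * I) (fun p => P (fst p) (snd p))) as [S HS].
    - intros [x i]; destruct (Hfin x i) as [L HL].
      exists L; intros S S' HSS; apply HL; auto.
    - intro l; destruct (H _ (map fst l) eq_refl) as [S HS]; exists S.
      intros [x i] Hx; simpl; apply HS with x; auto.
      apply (in_map fst) in Hx; exact Hx.
    - exists S; intros x i; exact (HS (x, i)). }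
  induction n as [|n IH]; intros l Hl.
  { exists (fun _ => True); destruct l; [intros x []|discriminate]. }
  destruct (list_maximal T le Htr l) as [x [Hx Hmax]].
  { intros ->; discriminate. }
  destruct (in_split x l Hx) as [l1 [l2 ->]].
  destruct (IH (l1 ++ l2)) as [S0 HS0].
  { rewrite length_app in *; simpl in Hl; lia. }
  assert (Hin : forall y, In y (l1 ++ x :: l2) <-> y = x \/ In y (l1 ++ l2)).
  { intro y; rewrite !in_app_iff; simpl; intuition congruence. }
  (* If some other listed element lies above the maximal [x], it is equivalent to [x], and [S0]
     already solves that class. *)
  destruct (classic (exists y, In y (l1 ++ l2) /\ le x y)) as [[z [Hz Hxz]]|Hno].
  - exists S0; intros y Hy; apply Hin in Hy; destruct Hy as [->|Hy]; [|now apply HS0].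
    assert (Hzx : le z x) by (apply Hmax; auto; apply Hin; auto).
    intros y i H1 H2; apply HS0 with z; eauto.
  - destruct (Hloc x S0) as [S [Hoff Hon]]; exists S.
    intros y Hy; apply Hin in Hy; destruct Hy as [->|Hy]; [now apply Hon|].
    (* This constraint reads only elements below [z]; one in the class of [x] would put [x] below
       [y], against [Hno]. *)
    intros z i Hyz Hzy; destruct (Hfin z i) as [L HL].
    apply HL with S0; [|now apply HS0 with y].
    intros w _ Hwz; symmetry; apply Hoff; intros [Hxw _].
    apply Hno; exists y; split; eauto.
Qed.

(** * Maximal ranges *)

(* [b = False] gives the set itself (naive), [b = True] the range (stage). *)
Definition rng (b : Prop) {T : Type} (G : AF T) (A : T -> Prop) (x : T) : Prop :=
  A x \/ (b /\ exists y, A y /\ att G y x).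

Definition max_rng (b : Prop) {T : Type} (G : AF T) (A : T -> Prop) : Prop :=
  conflict_free G A /\
  ~ exists A', conflict_free G A' /\ strict_subset (rng b G A) (rng b G A').

Lemma naive_max_rng (T : Type) (G : AF T) (A : T -> Prop) :
  naive G A <-> max_rng False G A.
Proof.
  assert (E : forall A' x, rng False G A' x <-> A' x) by (unfold rng; tauto).
  split; intros [Hcf Hmax]; split; auto.
  - intros [A' [Hcf' [Hsub [x [Hx Hnx]]]]]; apply Hnx, E, (Hmax A'); auto.
    + intros y Hy; apply E, Hsub, E, Hy.
    + now apply E.
  - intros A' Hcf' Hsub x Hx; apply NNPP; intro Hnx; apply Hmax.
    exists A'; split; auto; split.
    + intros y Hy; apply E, Hsub, E, Hy.
    + exists x; rewrite !E; auto.
Qed.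

Lemma stage_max_rng (T : Type) (G : AF T) (A : T -> Prop) :
  stage G A <-> max_rng True G A.
Proof.
  assert (E : rng True G = range G).
  { apply functional_extensionality; intro A'; apply pred_ext; intro x.
    unfold rng, range; tauto. }
  unfold stage, max_rng; rewrite E; tauto.
Qed.

Definition coverable (b : Prop) {T : Type} (G : AF T) (l : list T) : Prop :=
  exists A, conflict_free G A /\ forall x, In x l -> rng b G A x.

(** Only the arguments to be covered are fixed; the covering sets behind successive decisions may be
    unrelated. Entries of [e] may repeat or lie outside [G]. *)
Fixpoint greedy (b : Prop) {T : Type} (G : AF T) (e : nat -> T) (n : nat) : list T :=
  match n with
  | 0 => []
  | S m => if excluded_middle_informative (coverable b G (e m :: greedy b G e m))
           then e m :: greedy b G e m else greedy b G e m
  end.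

Lemma greedy_coverable (b : Prop) (T : Type) (G : AF T) (e : nat -> T) (n : nat) :
  coverable b G (greedy b G e n).
Proof.
  induction n as [|n IH]; simpl.
  - exists (fun _ => False); split; [split; [intros x []|intros x y []]|intros x []].
  - destruct (excluded_middle_informative _); auto.
Qed.

Lemma greedy_incl (b : Prop) (T : Type) (G : AF T) (e : nat -> T) (n m : nat) :
  n <= m -> incl (greedy b G e n) (greedy b G e m).
Proof.
  induction 1 as [|m _ IH]; [apply incl_refl|]; simpl.
  destruct (excluded_middle_informative _); auto; now apply incl_tl.
Qed.

Lemma greedy_enumerated (b : Prop) (T : Type) (G : AF T) (e : nat -> T) (n : nat) :
  incl (greedy b G e n) (map e (seq 0 n)).
Proof.
  induction n as [|n IH]; [apply incl_refl|].
  rewrite seq_S, map_app; simpl.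
  destruct (excluded_middle_informative _).
  - apply incl_cons; [apply in_or_app; right; now left|now apply incl_appl].
  - now apply incl_appl.
Qed.

(** Each prefix has its own covering set. Compactness merges them, since being covered at [x]
    depends only on [x] and its finitely many attackers. *)
Lemma greedy_covered (b : Prop) (T : Type) (G : AF T) (e : nat -> T) :
  finitary G ->
  exists A, conflict_free G A /\ forall n x, In x (greedy b G e n) -> rng b G A x.
Proof.
  intro Hfin.
  destruct (compactness T (T * nat) (fun p A =>
     (A (fst p) -> args G (fst p)) /\
     (forall y, att G y (fst p) -> ~ (A y /\ A (fst p))) /\
     (In (fst p) (greedy b G e (snd p)) -> rng b G A (fst p)))) as [A HA].
  - intros [x n]; simpl; destruct (Hfin x) as [L HL]; exists (x :: L).
    intros S S' HS; assert (Hx := HS x (or_introl eq_refl)).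
    assert (HS' : forall y, att G y x -> (S y <-> S' y)).
    { intros y Hy; apply HS; right; auto. }
    intros [H1 [H2 H3]]; split; [tauto|split].
    + intros y Hy; rewrite <- HS', <- Hx; auto.
    + intro Hin; destruct (H3 Hin) as [H|[Hb [y [Hy Hyx]]]]; [left; tauto|right].
      split; auto; exists y; rewrite <- HS'; auto.
  - intro l.
    (* The greedy lists increase, so covering the one at the largest index settles all constraints
       in [l]. *)
    assert (HN : exists N, forall p, In p l -> snd p <= N).
    { clear; induction l as [|[x n] l [N HN]]; [exists 0; intros p []|].
      exists (Nat.max n N); intros p [<-|Hp]; simpl; [lia|].
      specialize (HN p Hp); lia. }
    destruct HN as [N HN]; destruct (greedy_coverable b T G e N) as [A [Hcf Hcov]].
    exists A; intros p Hp; split; [apply Hcf|split].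
    + intros y Hy [H1 H2]; exact (proj2 Hcf _ _ H1 H2 Hy).
    + intro Hin; apply Hcov; exact (greedy_incl b T G e _ N (HN p Hp) _ Hin).
  - exists A; split.
    + split; [intros x; exact (proj1 (HA (x, 0)))|].
      intros x y Hx Hy Hxy; exact (proj1 (proj2 (HA (y, 0))) x Hxy (conj Hx Hy)).
    + intros n x; exact (proj2 (proj2 (HA (x, n)))).
Qed.

(** If [A'] had a strictly larger range, an extra argument [e n] would be coverable together with
    the list so far; [greedy] would have kept it, and [A] would cover it. *)
Lemma greedy_max_rng (b : Prop) (T : Type) (G : AF T) (e : nat -> T) (A : T -> Prop) :
  wf_AF G -> (forall x, args G x -> exists n, e n = x) ->
  conflict_free G A -> (forall n x, In x (greedy b G e n) -> rng b G A x) ->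
  max_rng b G A.
Proof.
  intros Hwf He Hcf HA; split; auto.
  intros [A' [Hcf' [Hsub [x [Hx Hnx]]]]].
  assert (Hax : args G x).
  { destruct Hx as [Hx|[_ [y [_ Hy]]]]; [now apply Hcf'|now apply Hwf in Hy]. }
  destruct (He x Hax) as [n <-].
  apply Hnx, (HA (S n)); simpl.
  destruct (excluded_middle_informative _) as [_|Hn]; [now left|].
  destruct Hn; exists A'; split; auto.
  intros y [<-|Hy]; auto; eapply Hsub, HA, Hy.
Qed.

(** * Strongly connected components *)

Section Components.
Variables (T : Type) (F : AF T).
Hypothesis F_wf : wf_AF F.

(** Defined on the whole carrier, to match [preorder_compactness]; a point that is not an argument
    is a class by itself. *)
Definition scc (a x : T) : Prop := reach F a x /\ reach F x a.

Lemma reach_args (x y : T) : reach F x y -> (args F x <-> args F y).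
Proof.
  induction 1 as [x y H| |]; [apply F_wf in H|..]; tauto.
Qed.

Lemma is_SCC_scc (a : T) (X : T -> Prop) : args F a ->
  (forall x, X x <-> (args F x /\ reach F a x /\ reach F x a)) -> X = scc a.
Proof.
  intros Ha H; apply pred_ext; intro x; rewrite H; unfold scc.
  split; [tauto|intros [H1 H2]; apply reach_args in H1 as H3; tauto].
Qed.

Lemma scc_eq (a x : T) : scc a x -> scc a = scc x.
Proof.
  intros [H1 H2]; apply pred_ext; intro y; unfold scc; unfold reach in *.
  split; intros [H3 H4]; split; eapply rt_trans; eauto.
Qed.

(** A fixed representative lets all members of a component share one enumeration, hence one greedy
    list. *)
Definition scc_rep (x : T) : T := epsilon (inhabits x) (scc x).

Lemma scc_rep_spec (x : T) : scc x (scc_rep x).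
Proof.
  unfold scc_rep; apply epsilon_spec; exists x; split; apply rt_refl.
Qed.

Lemma scc_rep_eq (a x : T) : scc a x -> scc_rep a = scc_rep x.
Proof.
  (* After rewriting, the [epsilon] terms differ only in their proofs of inhabitation. *)
  intro H; unfold scc_rep; rewrite (scc_eq a x H); f_equal; apply proof_irrelevance.
Qed.

Variable attackers : T -> list T.
Hypothesis attackers_spec : forall x y, att F y x -> In y (attackers x).

Fixpoint ancestors (a : T) (n : nat) : list T :=
  match n with
  | 0 => [a]
  | S m => flat_map attackers (ancestors a m)
  end.

(** Witnesses that components are countable: [n] codes a level and a position in it. The default [a]
    is itself an ancestor. *)
Definition enum_ancestors (a : T) (n : nat) : T :=
  let (i, k) := Cantor.of_nat n in nth k (ancestors a i) a.

Lemma enum_ancestors_surj (a x : T) : reach F x a -> exists n, enum_ancestors a n = x.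
Proof.
  intro H; apply clos_rt_rt1n in H.
  enough (exists i, In x (ancestors a i)) as [i Hi].
  { destruct (In_nth _ _ a Hi) as [k [_ Hk]].
    exists (Cantor.to_nat (i, k)); unfold enum_ancestors.
    now rewrite Cantor.cancel_of_to. }
  induction H as [a|x y a Hxy _ [i Hi]].
  - exists 0; now left.
  - exists (S i); apply in_flat_map; eauto.
Qed.

Definition available (S X : T -> Prop) : AF T :=
  restrict F (fun x => X x /\ ~ Dset F S X x).

Lemma available_wf (S X : T -> Prop) : wf_AF (available S X).
Proof.
  intros x y [H1 H2]; apply F_wf in H1; simpl; tauto.
Qed.

Lemma available_finitary (S X : T -> Prop) : finitary (available S X).
Proof.
  intro x; exists (attackers x); intros y [Hy _]; auto.
Qed.

Definition agree_above (K : list T) (x : T) (S S' : T -> Prop) : Prop :=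
  forall y, In y K -> reach F y x -> (S y <-> S' y).

(** Covering [l] involves [l] and its attackers, and membership of each of these in [Dset] is
    decided by its own attackers: hence two levels. *)
Definition dependency (l : list T) : list T :=
  flat_map attackers l ++ flat_map attackers (flat_map attackers l).

(** Members of this [Dset] lie in the component of [a], so their attackers reach [a] and fall under
    [agree_above]. *)
Lemma Dset_agree (a : T) (K : list T) (S S' : T -> Prop) (x : T) :
  incl (attackers x) K -> agree_above K a S S' ->
  Dset F S (scc a) x <-> Dset F S' (scc a) x.
Proof.
  intros HK Hag.
  assert (H : forall y, scc a x -> att F y x -> (S y <-> S' y)).
  { intros y [_ Hx] Hy; apply Hag; [apply HK; auto|].
    eapply rt_trans; [apply rt_step|]; eauto. }
  split; intros [HX [y [H1 [H2 H3]]]]; split; auto; exists y;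
    [rewrite <- H | rewrite H]; auto.
Qed.

Lemma agree_above_sym (K : list T) (x : T) (S S' : T -> Prop) :
  agree_above K x S S' -> agree_above K x S' S.
Proof.
  intros H y Hy Hyx; symmetry; auto.
Qed.

(* A covering set can be cut down to [l] and its attackers, so coverability of
   [l] only sees the status of finitely many arguments. *)
Lemma coverable_agree (b : Prop) (a : T) (m l : list T) (S S' : T -> Prop) :
  incl l m -> agree_above (dependency m) a S S' ->
  coverable b (available S (scc a)) l -> coverable b (available S' (scc a)) l.
Proof.
  intros Hlm Hag [A [[Hsub Hcf] Hcov]].
  set (Q := l ++ flat_map attackers l).
  assert (HQ : forall x, In x Q -> Dset F S (scc a) x <-> Dset F S' (scc a) x).
  { intros x Hx; apply Dset_agree with (dependency m); auto.
    unfold dependency; apply in_app_or in Hx; destruct Hx as [Hx|Hx]; intros y Hy.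
    - apply in_or_app; left; apply in_flat_map; eauto.
    - apply in_or_app; right; apply in_flat_map; exists x; split; auto.
      apply in_flat_map in Hx; destruct Hx as [z [Hz Hxz]].
      apply in_flat_map; eauto. }
  exists (fun x => A x /\ In x Q); split; [split|].
  - intros x [Hx Hq]; specialize (Hsub x Hx); simpl in *; rewrite <- HQ; auto.
  - intros x y [Hx Hqx] [Hy Hqy] [Hxy _].
    apply (Hcf x y Hx Hy); split; auto; split; [apply (Hsub x)|apply (Hsub y)]; auto.
  - intros x Hx; assert (Hqx : In x Q) by (apply in_or_app; auto).
    destruct (Hcov x Hx) as [H|[Hb [y [Hy [Hyx [Hy' Hx']]]]]]; [left; auto|right].
    assert (Hqy : In y Q).
    { apply in_or_app; right; apply in_flat_map; eauto. }
    split; auto; exists y; split; auto; split; auto.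
    rewrite <- !HQ; auto.
Qed.

(** Once the lists so far coincide, the next decision concerns a list inside [m]. Fixing [m] keeps
    the agreement hypothesis the same throughout the induction. *)
Lemma greedy_agree (b : Prop) (a : T) (e : nat -> T) (m : list T) (S S' : T -> Prop) n :
  incl (map e (seq 0 n)) m -> agree_above (dependency m) a S S' ->
  greedy b (available S (scc a)) e n = greedy b (available S' (scc a)) e n.
Proof.
  intros Hm Hag; induction n as [|n IH]; auto.
  rewrite seq_S, map_app in Hm; apply incl_app_inv in Hm; destruct Hm as [Hm He].
  specialize (IH Hm); simpl; rewrite <- IH.
  assert (Hi : incl (e n :: greedy b (available S (scc a)) e n) m).
  { apply incl_cons; [apply He; now left|].
    eapply incl_tran; [apply greedy_enumerated|]; auto. }
  destruct (excluded_middle_informative _) as [H|H];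
    destruct (excluded_middle_informative _) as [H'|H']; auto; exfalso.
  - apply H'; eapply coverable_agree; eauto.
  - apply H; eapply coverable_agree; eauto using agree_above_sym.
Qed.

(** Splitting by [x] and [n] makes each constraint finitary. The first clause also excludes
    attackers outside the component. *)
Definition scc_constraint (b : Prop) (x : T) (n : nat) (S : T -> Prop) : Prop :=
  (forall y, att F y x -> ~ (S y /\ S x)) /\
  (In x (greedy b (available S (scc x)) (enum_ancestors (scc_rep x)) n) ->
   rng b (available S (scc x)) (inter S (scc x)) x).

Lemma scc_constraint_agree (b : Prop) (x : T) (n : nat) :
  exists K, forall S S', agree_above K x S S' ->
    scc_constraint b x n S -> scc_constraint b x n S'.
Proof.
  set (e := enum_ancestors (scc_rep x)).
  (* Including [x] puts its attackers, which may cover it, and their attackers, which decide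
     availability, into [dependency m]. *)
  set (m := x :: map e (seq 0 n)).
  exists (x :: dependency m); intros S S' Hag.
  assert (Hx : S x <-> S' x) by (apply Hag; [now left|apply rt_refl]).
  assert (Hd : agree_above (dependency m) x S S').
  { intros y Hy; apply Hag; now right. }
  assert (Hatt : forall y, att F y x -> (S y <-> S' y)).
  { intros y Hy; apply Hd; [|now apply rt_step].
    apply in_or_app; left; apply in_or_app; left; auto. }
  intros [H1 H2]; split.
  - intros y Hy; rewrite <- Hatt, <- Hx; auto.
  - fold e in H2 |- *.
    rewrite <- (greedy_agree b x e m S S' n) by (auto; apply incl_tl, incl_refl).
    intro Hin; destruct (H2 Hin) as [[H Hs]|[Hb [y [[Hy Hs] [Hyx Hav]]]]].
    + left; split; tauto.
    + right; split; auto; exists y; split; [split; auto; rewrite <- Hatt; auto|].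
      split; auto.
      rewrite <- !(Dset_agree x (dependency m) S S'); auto.
      * intros z Hz; apply in_or_app; left; apply in_or_app; left; auto.
      * intros z Hz; apply in_or_app; right; apply in_flat_map; exists y; split; auto.
        apply in_or_app; left; auto.
Qed.

Lemma Dset_off (S S' X : T -> Prop) (x : T) :
  (forall y, ~ X y -> (S y <-> S' y)) -> Dset F S X x <-> Dset F S' X x.
Proof.
  intro H; split; intros [HX [y [H1 [H2 H3]]]]; split; auto; exists y;
    [rewrite <- H | rewrite H]; auto.
Qed.

(** [Dset] consults [S] only outside [X], so the available framework is known before [S] is chosen
    on [X]. *)
Lemma available_off (S S' X : T -> Prop) :
  (forall y, ~ X y -> (S y <-> S' y)) -> available S X = available S' X.
Proof.
  intro H; unfold available; f_equal; apply pred_ext; intro x.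
  now rewrite (Dset_off S S' X x H).
Qed.

Lemma scc_constraint_local (b : Prop) (x : T) (S0 : T -> Prop) :
  exists S, (forall y, ~ scc x y -> (S y <-> S0 y)) /\
    forall y n, scc x y -> scc_constraint b y n S.
Proof.
  destruct (greedy_covered b T (available S0 (scc x)) (enum_ancestors (scc_rep x))
              (available_finitary S0 (scc x))) as [A [[Hsub Hcf] Hcov]].
  set (S := fun y => (scc x y /\ A y) \/ (~ scc x y /\ S0 y)).
  assert (Hoff : forall y, ~ scc x y -> (S y <-> S0 y)) by (unfold S; tauto).
  assert (Hon : inter S (scc x) = A).
  { apply pred_ext; intro y; unfold inter, S.
    split; [tauto|intro Hy; specialize (Hsub y Hy); simpl in Hsub; tauto]. }
  exists S; split; auto.
  intros y n Hy; unfold scc_constraint.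
  rewrite <- (scc_eq x y Hy), <- (scc_rep_eq x y Hy).
  rewrite (available_off S S0 (scc x) Hoff), Hon.
  split; [|apply Hcov].
  intros z Hzy [HSz HSy].
  assert (Ay : A y) by (rewrite <- Hon; split; auto).
  destruct (Hsub y Ay) as [_ [_ HD]].
  destruct (classic (scc x z)) as [Hz|Hz].
  - assert (Az : A z) by (rewrite <- Hon; split; auto).
    apply (Hcf z y Az Ay); split; auto; split; [apply (Hsub z Az)|apply (Hsub y Ay)].
  - apply HD; split; auto; exists z; rewrite <- Hoff; auto.
Qed.

Lemma scc_constraint_max_rng (b : Prop) (a : T) (S : T -> Prop) :
  args F a -> (forall x n, scc a x -> scc_constraint b x n S) ->
  max_rng b (available S (scc a)) (inter S (scc a)).
Proof.
  intros Ha H.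
  assert (Hcf : conflict_free (available S (scc a)) (inter S (scc a))).
  { split.
    - intros x [Hx Hax]; simpl; split; [apply (reach_args a x); auto; apply Hax|].
      split; auto; intros [_ [y [Hy [_ Hyx]]]].
      destruct (H x 0 Hax) as [H1 _]; exact (H1 y Hyx (conj Hy Hx)).
    - intros x y [Hx _] [Hy Hay] [Hxy _].
      destruct (H y 0 Hay) as [H1 _]; exact (H1 x Hxy (conj Hx Hy)). }
  apply greedy_max_rng with (e := enum_ancestors (scc_rep a)); auto.
  - apply available_wf.
  - intros x [_ [Hx _]]; apply enum_ancestors_surj.
    apply rt_trans with a; [apply Hx|apply scc_rep_spec].
  - intros n x Hin.
    (* The enumeration may leave the component, but whatever is coverable in the available framework
       belongs to it. *)
    assert (Hax : scc a x).
    { destruct (greedy_coverable b T (available S (scc a)) (enum_ancestors (scc_rep a)) n)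
        as [A [[Hsub _] Hcov]].
      destruct (Hcov x Hin) as [Hx|[_ [y [_ [_ [_ Hx]]]]]];
        [apply (Hsub x Hx)|apply Hx]. }
    destruct (H x n Hax) as [_ H2].
    rewrite <- (scc_eq a x Hax), <- (scc_rep_eq a x Hax) in H2; auto.
Qed.

End Components.

(** * Directionality *)

Definition sem15 (b : Prop) {T : Type} (F : AF T) (S : T -> Prop) : Prop :=
  conflict_free F S /\
  forall X, is_SCC F X -> max_rng b (available T F S X) (inter S X).

Lemma cf15_sem15 (T : Type) : @cf15 T = @sem15 False T.
Proof.
  apply functional_extensionality; intro F; apply pred_ext; intro S.
  unfold cf15, sem15; split; intros [H1 H2]; split; auto; intros X HX;
    apply naive_max_rng, H2, HX.
Qed.

Lemma stg15_sem15 (T : Type) : @stg15 T = @sem15 True T.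
Proof.
  apply functional_extensionality; intro F; apply pred_ext; intro S.
  unfold stg15, sem15; split; intros [H1 H2]; split; auto; intros X HX;
    apply stage_max_rng, H2, HX.
Qed.

Section Unattacked.
Variables (T : Type) (F : AF T) (U : T -> Prop).
Hypotheses (F_wf : wf_AF F) (U_args : subset_of U (args F)) (U_unatt : unattacked F U).

Lemma att_unattacked (x y : T) : att F x y -> U y -> U x.
Proof.
  intros Hxy Hy; apply NNPP; intro Hx.
  apply (U_unatt x y); auto; now apply F_wf in Hxy.
Qed.

Lemma reach_unattacked (x y : T) : reach F x y -> U y -> U x.
Proof.
  induction 1; eauto using att_unattacked.
Qed.

Lemma restrict_wf : wf_AF (restrict F U).
Proof.
  intros x y [H1 H2]; apply F_wf in H1; simpl; tauto.
Qed.

(** A path ending in [U] never leaves [U], because [U] contains all attackers of its members. *)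
Lemma reach_restrict (x y : T) : U y -> (reach (restrict F U) x y <-> reach F x y).
Proof.
  intro Hy; split.
  - clear Hy; induction 1 as [x y [H _]| |]; [now apply rt_step|apply rt_refl|].
    eapply rt_trans; eauto.
  - intro H; induction H as [x y H| |x y z H1 IH1 H2 IH2].
    + apply rt_step; split; eauto using att_unattacked.
    + apply rt_refl.
    + apply rt_trans with y; [apply IH1, (reach_unattacked y z)|apply IH2]; auto.
Qed.

Lemma scc_restrict (a : T) : U a -> scc T (restrict F U) a = scc T F a.
Proof.
  intro Ha; apply pred_ext; intro x; unfold scc.
  rewrite (reach_restrict x a Ha); split; intros [H1 H2]; split; auto;
    apply (reach_restrict a x) in H1 || apply (reach_restrict a x);
    eauto using reach_unattacked.
Qed.

(** All attackers of [X] lie in [U], where [E] and [S] agree, so both sides have the same [Dset]. *)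
Lemma available_restrict (S E X : T -> Prop) :
  subset_of X U -> (forall x, E x <-> (S x /\ U x)) ->
  available T (restrict F U) E X = available T F S X.
Proof.
  intros HX HE.
  assert (HD : forall x, Dset (restrict F U) E X x <-> Dset F S X x).
  { intro x; split; intros [Hx [y [Hy [HyX Hyx]]]]; split; auto; exists y.
    - rewrite HE in Hy; simpl in Hyx; tauto.
    - assert (U y) by eauto using att_unattacked.
      rewrite HE; simpl; auto 10. }
  apply AF_ext; simpl; intros; rewrite !HD; specialize (HX x) as Hx;
    try specialize (HX y) as Hy; tauto.
Qed.

Lemma inter_restrict (S E X : T -> Prop) :
  subset_of X U -> (forall x, E x <-> (S x /\ U x)) -> inter E X = inter S X.
Proof.
  intros HX HE; apply pred_ext; intro x; unfold inter; rewrite HE.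
  specialize (HX x); tauto.
Qed.

Lemma scc_subset (a : T) : U a -> subset_of (scc T F a) U.
Proof.
  intros Ha x [_ Hx]; eauto using reach_unattacked.
Qed.

Lemma sem15_restrict_scc (b : Prop) (S E : T -> Prop) (a : T) :
  U a -> (forall x, E x <-> (S x /\ U x)) ->
  max_rng b (available T (restrict F U) E (scc T (restrict F U) a))
    (inter E (scc T (restrict F U) a)) <->
  max_rng b (available T F S (scc T F a)) (inter S (scc T F a)).
Proof.
  intros Ha HE; rewrite (scc_restrict a Ha).
  rewrite (available_restrict S E), (inter_restrict S E); auto using scc_subset.
  tauto.
Qed.

Lemma is_SCC_of_scc (G : AF T) (a : T) : wf_AF G -> args G a -> is_SCC G (scc T G a).
Proof.
  intros HG Ha; exists a; split; auto; intro x; unfold scc.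
  split; [intros [H1 H2]; apply (reach_args T G HG) in H1 as H3|]; tauto.
Qed.

Lemma sem15_restrict (b : Prop) (S E : T -> Prop) :
  sem15 b F S -> (forall x, E x <-> (S x /\ U x)) -> sem15 b (restrict F U) E.
Proof.
  intros [[Hsub Hcf] HS] HE; split; [split|].
  - intros x Hx; apply HE in Hx; destruct Hx; split; auto.
  - intros x y Hx Hy [Hxy _]; apply HE in Hx, Hy; eapply Hcf; [..|exact Hxy]; tauto.
  - intros X [a [[Ha Hua] HX]].
    rewrite (is_SCC_scc T (restrict F U) restrict_wf a X (conj Ha Hua) HX).
    apply (sem15_restrict_scc b S E a Hua HE), HS, is_SCC_of_scc; auto.
Qed.

Lemma sem15_extend (b : Prop) (E : T -> Prop) :
  finitary F -> sem15 b (restrict F U) E ->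
  exists S, sem15 b F S /\ forall x, E x <-> (S x /\ U x).
Proof.
  intros Hfin [[Esub Ecf] HE].
  destruct (choice _ Hfin) as [attackers Hatt].
  set (free x := args F x /\ ~ U x).
  (* Off [free], [S] must copy [E]; this covers [U] and also the points that are not arguments,
     where [E] is empty. *)
  set (P x n S := (free x -> scc_constraint T F attackers b x n S) /\
                  (~ free x -> (S x <-> E x))).
  assert (free_scc : forall x y, scc T F x y -> (free x <-> free y)).
  { intros x y [H1 H2]; unfold free; rewrite (reach_args T F F_wf x y H1).
    assert (U x <-> U y) by (split; eauto using reach_unattacked); tauto. }
  destruct (preorder_compactness T nat (reach F) P) as [S HS].
  - intro x; apply rt_refl.
  - intros x y z; apply rt_trans.
  - intros x n; destruct (scc_constraint_agree T F attackers Hatt b x n) as [K HK].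
    exists (x :: K); intros S S' Hag [H1 H2]; split.
    + intro Hx; apply HK with S; auto; intros y Hy; apply Hag; now right.
    + rewrite <- (Hag x); auto; [now left|apply rt_refl].
  - intros x S0; destruct (classic (free x)) as [Hx|Hx].
    + destruct (scc_constraint_local T F attackers Hatt b x S0) as [S [Hoff Hon]].
      exists S; split; auto; intros y n H1 H2; split.
      * intros _; apply Hon; split; auto.
      * intro Hy; destruct Hy; apply (free_scc x); auto; split; auto.
    + exists (fun y => (scc T F x y /\ E y) \/ (~ scc T F x y /\ S0 y)); split.
      * intros y Hy; unfold scc; tauto.
      * intros y n H1 H2; assert (Hxy : scc T F x y) by (split; auto); split.
        -- intro Hy; destruct Hx; apply (free_scc x y); auto.
        -- tauto.
  - assert (HSE : forall x, E x <-> (S x /\ U x)).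
    { intro x; destruct (HS x 0) as [_ H]; unfold free in H.
      specialize (Esub x); simpl in Esub; tauto. }
    exists S; split; auto; split; [split|].
    + intros x Hx; apply NNPP; intro Hn; apply Hn.
      destruct (HS x 0) as [_ H]; unfold free in H; apply Esub, H; tauto.
    (* An attack on a member of [U] comes from [U], where [E] is conflict-free; any other attack is
       excluded by the constraint at its target, at the arbitrary index [0]. *)
    + intros x y Hx Hy Hxy; destruct (classic (U y)) as [Hu|Hu].
      * assert (Hux : U x) by eauto using att_unattacked.
        apply (Ecf x y); [apply HSE; auto..|split; auto].
      * destruct (HS y 0) as [[H _] _]; [split; auto; now apply F_wf in Hxy|].
        exact (H x Hxy (conj Hx Hy)).
    + intros X [a [Ha HX]]; rewrite (is_SCC_scc T F F_wf a X Ha HX).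
      destruct (classic (U a)) as [Hu|Hu].
      * apply (sem15_restrict_scc b S E a Hu HSE), HE, is_SCC_of_scc;
          [apply restrict_wf|split; auto].
      * apply scc_constraint_max_rng with attackers; auto.
        intros x n Hx; apply HS, (free_scc a x Hx); split; auto.
Qed.

Lemma sem15_directional (b : Prop) : finitary F -> directional_at (@sem15 b T) F U.
Proof.
  intros Hfin E; split; [now apply sem15_extend|].
  intros [S [HS HE]]; eapply sem15_restrict; eauto.
Qed.

End Unattacked.

Theorem theorem6 (T : Type) (F : AF T) (U : T -> Prop) :
  wf_AF F -> finitary F -> subset_of U (args F) -> unattacked F U ->
  directional_at (@cf15 T) F U /\ directional_at (@stg15 T) F U.
Proof.
  intros Hwf Hfin HU Hun.
  rewrite cf15_sem15, stg15_sem15.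
  split; apply sem15_directional; auto.
Qed.
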